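(* Let $p>2$ be a prime and let $d\le e$ be positive integers. Then the automorphism group $G$ of a regular dessin with underlying graph $K_{p^d,p^e}$ is isomorphic to one of the following groups: (i) $\mathbf M_1(d,e,f)=\langle a,b\mid a^{p^e}=b^{p^d}=1,\ b^{-1}ab=a^{1+p^f}\rangle$ where either $1\le d\le f\le e\le d+f$, or $1\le f<d\le e\le d+f$; (ii) $\mathbf M_2(d,e,f)=\langle a,b\mid a^{p^d}=b^{p^e}=1,\ b^{-1}ab=a^{1+p^f}\rangle$ where $1\le f<d<e$; (iii) $\mathbf M_3(d,e,h,f)=\langle a,b\mid a^{p^h}=1,\ b^{p^{d+e-h}}=a^{p^d},\ b^{-1}ab=a^{1+p^f}\rangle$ where $h-d\le f<d<h<e$. Moreover, the groups listed (across all families and all admissible parameter values) are pairwise non-isomorphic.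
   Context: A dessin is a $2$-cell embedding of a connected bipartite graph with vertices properly coloured black and white into an orientable closed surface; its automorphisms are edge permutations preserving the graph structure and vertex colours and extending to orientation-preserving self-homeomorphisms of the surface; it is regular if the automorphism group acts transitively on edges. *)

(* Defs.v *)
From mathcomp Require Import all_boot all_fingroup.

Set Implicit Arguments.
Unset Strict Implicit.
Unset Printing Implicit Defensive.

Local Open Scope group_scope.

(* A dessin, given by a finite properly 2-coloured graph (multiple edges are
   allowed) and a rotation system: [rot_black] (resp. [rot_white]) sends an edge
   to the one that follows it, in the orientation of the surface, around its
   black (resp. white) end. By the Heffter-Edmonds theorem, rotation systems on
   a connected graph correspond to its 2-cell embeddings into oriented closed
   surfaces. The faces, which are not needed here, are given by the cycles of
   rot_black * rot_white. *)
Definition graph_adj (E B W : finType) (black_end : E -> B) (white_end : E -> W)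
    : rel (B + W) :=
  fun u v =>
    match u, v with
    | inl b, inr w | inr w, inl b =>
        [exists x, (black_end x == b) && (white_end x == w)]
    | _, _ => false
    end.

Record dessin : Type := Dessin {
  edge : finType;
  black : finType;
  white : finType;
  black_end : edge -> black;
  white_end : edge -> white;
  rot_black : {perm edge};
  rot_white : {perm edge};
  rot_blackP : forall x y : edge,
    (y \in porbit rot_black x) = (black_end x == black_end y);
  rot_whiteP : forall x y : edge,
    (y \in porbit rot_white x) = (white_end x == white_end y);
  dessin_connected : forall u v : black + white,
    connect (graph_adj black_end white_end) u v
}.

Section Automorphisms.

Variable D : dessin.

Definition preserves_coloured_graph (s : {perm edge D}) : bool :=
  [forall x, forall y,
    ((black_end (s x) == black_end (s y)) == (black_end x == black_end y)) &&
    ((white_end (s x) == white_end (s y)) == (white_end x == white_end y))].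

(* An automorphism of the embedded graph extends to an orientation-preserving
   self-homeomorphism of the surface exactly when it respects the rotations. *)
Definition preserves_rotations (s : {perm edge D}) : bool :=
  (s * rot_black D == rot_black D * s) && (s * rot_white D == rot_white D * s).

Definition dessin_aut : {set {perm edge D}} :=
  [set s | preserves_coloured_graph s && preserves_rotations s].

Lemma dessin_aut_group_set : group_set dessin_aut.
Proof.
apply/group_setP; split=> [|s t].
  rewrite inE /preserves_rotations !mul1g !mulg1 !eqxx !andbT.
  by apply/forallP=> x; apply/forallP=> y; rewrite !perm1 !eqxx.
rewrite !inE => /andP[/forallP gs /andP[/eqP sb /eqP sw]].
case/andP=> /forallP gt /andP[/eqP tb /eqP tw]; apply/andP; split.
  apply/forallP=> x; apply/forallP=> y; rewrite !permM.
  have /forallP/(_ y)/andP[/eqP <- /eqP <-] := gs x.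
  exact: (forallP (gt (s x)) (s y)).
by rewrite /preserves_rotations -!mulgA tb tw !mulgA sb sw !eqxx.
Qed.

Canonical dessin_aut_group : {group {perm edge D}} :=
  Group dessin_aut_group_set.

Definition regular_dessin : bool :=
  [transitive dessin_aut, on [set: edge D] | 'P].

(* The two vertex classes may be coloured either way round. *)
Definition underlying_complete_bipartite (m n : nat) : Prop :=
  ((#|black D| = m /\ #|white D| = n) \/ (#|black D| = n /\ #|white D| = m))
  /\ forall (b : black D) (w : white D),
       exists! x : edge D, black_end x = b /\ white_end x = w.

End Automorphisms.

Inductive listed_group : Type :=
  | M1 of nat & nat & nat
  | M2 of nat & nat & nat
  | M3 of nat & nat & nat & nat.

Definition group_degrees (t : listed_group) : nat * nat :=
  match t with
  | M1 d e _ => (d, e)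
  | M2 d e _ => (d, e)
  | M3 d e _ _ => (d, e)
  end.

Definition admissible (t : listed_group) : bool :=
  match t with
  | M1 d e f => [&& 1 <= d, d <= f, f <= e & e <= d + f]
             || [&& 1 <= f, f < d, d <= e & e <= d + f]
  | M2 d e f => [&& 1 <= f, f < d & d < e]
  (* [d < h] and [h < e], so the truncated subtractions below are exact. *)
  | M3 d e h f => [&& h - d <= f, f < d, d < h & h < e]
  end%N.

(* [G \isog Grp (...)] identifies G with the largest finite quotient of the
   presented group; the groups presented here are finite, being products of two
   cyclic subgroups of finite order. Recall that a ^ b is b^-1 * a * b. *)
Definition presented_by (p : nat) (t : listed_group) (gT : finGroupType)
    (G : {group gT}) : Prop :=
  match t with
  | M1 d e f =>
      G \isog Grp (a : b : a ^+ (p ^ e)%N, b ^+ (p ^ d)%N,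
                           a ^ b = a ^+ (1 + p ^ f)%N)
  | M2 d e f =>
      G \isog Grp (a : b : a ^+ (p ^ d)%N, b ^+ (p ^ e)%N,
                           a ^ b = a ^+ (1 + p ^ f)%N)
  | M3 d e h f =>
      G \isog Grp (a : b : a ^+ (p ^ h)%N,
                           b ^+ (p ^ (d + e - h))%N = a ^+ (p ^ d)%N,
                           a ^ b = a ^+ (1 + p ^ f)%N)
  end.

(* Main.v *)
Require Import Defs.
From mathcomp Require Import all_boot all_fingroup all_solvable zmodp zify.

(* A regular dessin on K_{m,n} has an automorphism group acting regularly on the
   edges, hence equal to a product <s><t> of two cyclic groups, of orders n and m,
   that meet trivially. For m and n powers of an odd prime p, such a product is
   metacyclic (Huppert): modulo a central subgroup N <= G' of order p it is
   metacyclic by induction, which forces G' to be cyclic, and then either a cyclic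
   normal subgroup of G/N lifts to a cyclic subgroup containing N, or G' = N. In the
   latter case a generator of G' is a p^r-th power x^(i p^r) y^(j p^r) = (x^i y^j)^(p^r)
   with i or j prime to p, and <x^i y^j> is normal with cyclic quotient.

   Choosing the normal cyclic subgroup <a> with cyclic quotient of maximal order
   gives generators with a^(p^h) = 1, b^(p^k) = a^(p^l), a^b = a^(1 + p^f), and
   either f < l < k (families M_2 and M_3), or k <= l; in that case b can be
   corrected by a power of a so that b^(p^k) = 1 (family M_1). If l < k and l <= f
   then <b> would be normal with cyclic quotient and larger than <a>. The order and
   exponent of G, the order of G' and the exponent of G/G' determine the group in
   the list. *)

Set Implicit Arguments.
Unset Strict Implicit.
Unset Printing Implicit Defensive.

(** * Geometric sums and powers modulo an odd prime power *)

(** This is (r^n - 1)/(r - 1), written as a sum so that neither a division nor a truncated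
    subtraction occurs and r = 1 is allowed. *)
Definition geo (r n : nat) := \sum_(i < n) r ^ i.

Lemma geoS r n : geo r n.+1 = (1 + r * geo r n)%N.
Proof.
rewrite /geo big_ord_recl expn0 big_distrr; congr (_ + _)%N.
by apply: eq_bigr => i _; rewrite lift0 expnS.
Qed.

Lemma geoD r m n : geo r (m + n) = (geo r m + r ^ m * geo r n)%N.
Proof.
rewrite /geo big_split_ord big_distrr; congr (_ + _)%N.
by apply: eq_bigr => i _; rewrite expnD.
Qed.

Lemma geoM r m n : geo r (m * n) = (geo r m * geo (r ^ m) n)%N.
Proof.
elim: n => [|n IHn]; first by rewrite muln0 /geo !big_ord0 muln0.
by rewrite mulnS geoD IHn geoS mulnDr muln1 mulnCA.
Qed.

Lemma expn_geo s n : ((1 + s) ^ n = 1 + s * geo (1 + s) n)%N.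
Proof. by rewrite -(predn_exp (1 + s)) [RHS]add1n prednK ?expn_gt0. Qed.

Lemma expn_mod1 q r n : r = 1 %[mod q] -> r ^ n = 1 %[mod q].
Proof. by move=> r1; rewrite -modnXm r1 modnXm exp1n. Qed.

Lemma geo_mod1 q r n : r = 1 %[mod q] -> geo r n = n %[mod q].
Proof.
move=> r1; elim: n => [|n IHn]; first by rewrite /geo big_ord0.
by rewrite geoS -modnDmr -modnMmr IHn modnMmr -modnMml r1 modnMml mul1n modnDmr.
Qed.

Lemma coprime_mod1 p m n :
  n = 1 %[mod p] -> coprime p (m * n) = coprime p m.
Proof. by move=> n1; rewrite -coprime_modr -modnMmr n1 modnMmr muln1 coprime_modr. Qed.

Lemma mod1_gt0 p u : 1 < p -> u = 1 %[mod p] -> 0 < u.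
Proof. by case: u => // p1; rewrite mod0n modn_small. Qed.

Lemma modular_inverse n s c : 1 < n -> coprime n s ->
  exists t, t * s = c %[mod n].
Proof.
move=> n_gt1 ns; have s0: 0 < s.
  by rewrite lt0n; apply: contraTneq ns => ->; rewrite /coprime gcdn0 gtn_eqF.
have [t q E _] := egcdnP n s0.
exists (t * c)%N; rewrite mulnAC E gcdnC (eqP ns).
by rewrite mulnDl mul1n mulnAC modnMDl.
Qed.

Section OddPrime.

Variable p : nat.
Hypotheses (p_pr : prime p) (p_gt2 : 2 < p).

Let p_gt1 : 1 < p. Proof. exact: prime_gt1. Qed.

(** Writing r = 1 + m p gives r^i = 1 + m p [geo r i], so the sum is p + m p times the sum of the
    [geo r i] for i < p. Modulo p the latter is the sum of the i < p, that is 'C(p, 2), which p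
    divides because p is odd. *)
Lemma geo_prime r : r = 1 %[mod p] ->
  exists2 u, u = 1 %[mod p] & geo r p = (p * u)%N.
Proof.
move=> r1; have r0 := mod1_gt0 p_gt1 r1.
have /dvdnP[m Em]: p %| r - 1 by rewrite -eqn_mod_dvd ?r1.
have {Em}Er: r = (1 + m * p)%N by rewrite -Em subnKC.
exists (1 + m * \sum_(i < p) geo r i)%N; last first.
  rewrite mulnDr muln1 {1}/geo {1}Er.
  under eq_bigr do rewrite expn_geo -Er.
  by rewrite big_split -big_distrr /= sum_nat_const card_ord; lia.
rewrite -modnDmr -modnMmr.
suff ->: \sum_(i < p) geo r i = 0 %[mod p] by rewrite mod0n muln0 mod0n.
have ->: \sum_(i < p) geo r i = \sum_(i < p) i %[mod p].
  elim/big_rec2: _ => //= i y1 y2 _ E.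
  by rewrite -modnDm E (geo_mod1 _ r1) modnDm.
have /eqP E := prime_dvd_bin p_pr (p_gt2 : 0 < 2 < p).
by rewrite mod0n -[RHS]E -bin2_sum big_mkord.
Qed.

Lemma geo_pexp r n : r = 1 %[mod p] ->
  exists2 u, u = 1 %[mod p] & geo r (p ^ n) = (p ^ n * u)%N.
Proof.
move=> r1; elim: n => [|n [u u1 Eu]]; first by exists 1%N; rewrite // expn0 /geo big_ord1.
have [v v1 Ev] := geo_prime (expn_mod1 (p ^ n) r1).
exists (u * v)%N; last by rewrite expnSr geoM Eu Ev; lia.
by rewrite -modnMm u1 v1 modnMm.
Qed.

Lemma mod1_pexp s f : 0 < f -> (1 + s * p ^ f) = 1 %[mod p].
Proof. by case: f => // f _; rewrite expnS mulnCA -modnDmr modnMr. Qed.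

Lemma expn_pexp s f n : 0 < f ->
  exists2 u, u = 1 %[mod p] &
    ((1 + s * p ^ f) ^ (p ^ n) = 1 + s * u * p ^ (f + n))%N.
Proof.
move=> f0; have [u u1 E] := geo_pexp n (mod1_pexp s f0).
by exists u => //; rewrite expn_geo E expnD; lia.
Qed.

(* The residues congruent to 1 modulo p^f form a cyclic group modulo p^h; t is
   found by Hensel lifting on h. *)
Lemma exists_expn_mod s f h : 0 < f -> coprime p s ->
  exists2 t, coprime p t & (1 + s * p ^ f) ^ t = 1 + p ^ f %[mod p ^ h].
Proof.
move=> f0 ps; pose r := (1 + s * p ^ f)%N; rewrite -/r.
have [hf | fh] := leqP h f.
  exists 1%N; first by rewrite coprimen1.
  by rewrite /r -(subnKC hf) expnD expn1 mulnCA -modnDmr modnMr -[RHS]modnDmr modnMr.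
rewrite -(subnKC fh); elim: (h - f.+1) => [|n [t pt IH]].
  (* Modulo p^(f+1), r^t = 1 + s p^f [geo r t] with [geo r t] congruent to t modulo p, so an inverse
     of s modulo p works. *)
  have [t E] := modular_inverse 1 p_gt1 ps; exists t.
    have: coprime p (t * s) by rewrite -coprime_modr E coprime_modr coprimen1.
    by rewrite coprimeMr => /andP[].
  have E2: p ^ f * (s * geo r t) = p ^ f * 1 %[mod p ^ f.+1].
    rewrite expnSr -!muln_modr -[s * _ %% p]modnMmr; congr (_ * _)%N.
    by rewrite geo_mod1 ?mod1_pexp // modnMmr mulnC E.
  by rewrite addn0 expn_geo -/r -modnDmr -mulnA mulnCA E2 muln1 modnDmr.
set h' := (f.+1 + n)%N in IH *; rewrite addnS -/h'.
have [u u1 Eu] := expn_pexp s (h' - f) f0.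
have fh' : f <= h' by rewrite /h'; lia.
rewrite subnKC // -/r in Eu.
have pu : coprime p (s * u) by rewrite coprime_mod1.
have [c Ec]: exists c, r ^ t + c * p ^ h' = 1 + p ^ f %[mod p ^ h'.+1].
  move: IH; set A := r ^ t; set B := 1 + p ^ f; set P := p ^ h' => IH.
  (* [p.-1] serves as -1 modulo p: the quotient of A by P is cancelled up to a multiple of P p. *)
  exists (B %/ P + p.-1 * (A %/ P))%N.
  rewrite {1}(divn_eq A P) {2}(divn_eq B P) IH expnSr -/P.
  have -> : A %/ P * P + B %% P + (B %/ P + p.-1 * (A %/ P)) * P
      = A %/ P * (P * p) + (B %/ P * P + B %% P).
    by rewrite -{2}(prednK (ltnW p_gt1)); lia.
  by rewrite modnMDl.
set A := r ^ t in Ec *; set P := p ^ h' in Eu Ec *.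
(* Since r^(p^(h'-f)) = 1 + s u p^h', adding m p^(h'-f) to the exponent t adds s u m p^h' modulo
   p^(h'+1). The choice of m makes this the missing c p^h'. *)
have [m Em] := modular_inverse c p_gt1 pu.
exists (t + p ^ (h' - f) * m)%N.
  case: (h' - f) (subn_gt0 f h') => [|j _]; first by rewrite /h'; lia.
  by rewrite expnS -mulnA -coprime_modr -modnDmr mulnC modnMl addn0 coprime_modr.
rewrite -Ec expnD expnM Eu expn_geo mulnDr muln1 -modnDmr -[RHS]modnDmr.
congr ((_ + _) %% _)%N; rewrite -Eu -/P -/A.
have ->: A * (s * u * P * geo (r ^ p ^ (h' - f)) m)
    = P * (A * (s * u * geo (r ^ p ^ (h' - f)) m)) by lia.
rewrite (mulnC c) expnSr -/P -!muln_modr; congr (_ * _)%N.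
have r1 : r = 1 %[mod p] by apply: mod1_pexp.
rewrite -modnMm -[_ * geo _ _ %% p]modnMmr (expn_mod1 _ r1) geo_mod1 ?expn_mod1 //.
by rewrite modnMm mul1n modnMmr mulnC Em.
Qed.
End OddPrime.

Local Open Scope group_scope.

(** * Metacyclic p-groups *)

(** The subgroups of a cyclic p-group form a chain, so one of [<[x]>], [<[y]>] contains the
    other. *)
Lemma cyclic_pgroup_gen2 (p : nat) (gT : finGroupType) (G : {group gT}) x y :
  p.-group G -> cyclic G -> <<[set x; y]>> = G -> <[x]> = G \/ <[y]> = G.
Proof.
move=> pG cG genG.
have Gx : x \in G by rewrite -genG mem_gen // !inE eqxx.
have Gy : y \in G by rewrite -genG mem_gen // !inE eqxx orbT.
have [i Ei] := p_natP (mem_p_elt pG Gx); have [j Ej] := p_natP (mem_p_elt pG Gy).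
have sub_gen (u v : gT) : u \in <[v]> -> [set u; v] \subset <[v]>.
  by move=> uv; apply/subsetP=> z; rewrite !inE => /orP[] /eqP->; rewrite ?cycle_id.
case/orP: (leq_total i j) => ij; [right | left]; apply/eqP.
  rewrite eqEsubset cycle_subG Gy -genG gen_subG sub_gen //.
  by rewrite -cycle_subG -(cardSg_cyclic cG) ?cycle_subG // -!orderE Ei Ej dvdn_exp2l.
rewrite eqEsubset cycle_subG Gx -genG gen_subG setUC sub_gen //.
by rewrite -cycle_subG -(cardSg_cyclic cG) ?cycle_subG // -!orderE Ei Ej dvdn_exp2l.
Qed.

Section Metacyclic.

Variable gT : finGroupType.
Implicit Types (a b x y z : gT) (G H K : {group gT}).

Lemma conjgX_expn a b r n : a ^ b = a ^+ r -> a ^ (b ^+ n) = a ^+ (r ^ n).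
Proof.
move=> ab; elim: n => [|n IHn]; first by rewrite conjg1.
by rewrite expgSr conjgM IHn conjXg ab -expgM expnS.
Qed.

Lemma expMg_geo a b r i m :
  a ^ b = a ^+ r -> (b * a ^+ i) ^+ m = b ^+ m * a ^+ (i * geo r m).
Proof.
move=> ab; elim: m => [|m IHm]; first by rewrite !expg0 /geo big_ord0 muln0 mulg1.
rewrite expgSr IHm -mulgA [a ^+ _ * _]mulgA [a ^+ _ * b]conjgC conjXg ab.
by rewrite expgSr -!mulgA -expgM -expgD geoS; congr (_ * (_ * _ ^+ _)); lia.
Qed.

Lemma quotient_cycle_mulg G H b :
  H <| G -> b \in G -> G / H = <[coset H b]> -> H * <[b]> = G.
Proof.
move=> /andP[sHG nG] Gb defGH; have nb : b \in 'N(H) by apply: subsetP Gb.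
by rewrite -quotientK ?cycle_subG // quotient_cycle // -defGH quotientK // mulSGid.
Qed.

Lemma cyclic_quotient_mulg G H :
  H <| G -> cyclic (G / H) -> exists2 b, b \in G & H * <[b]> = G.
Proof.
move=> nHG /cyclicP[B defGH].
have: B \in G / H by rewrite defGH cycle_id.
case/morphimP=> b Nb Gb defB; exists b => //.
by apply: quotient_cycle_mulg; rewrite // defGH defB.
Qed.

Lemma mulg_cyclic_quotient G H b :
  H <| G -> H * <[b]> = G -> cyclic (G / H).
Proof.
move=> /andP[_ nHG] defG.
have nb : b \in 'N(H) by rewrite -cycle_subG (subset_trans _ nHG) // -defG mulG_subr.
by rewrite -defG quotientMidl quotient_cycle // cycle_cyclic.
Qed.

Lemma metacyclic_mulgP G :
  reflect (exists a b, <[a]> <| G /\ <[a]> * <[b]> = G) (metacyclic G).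
Proof.
apply: (iffP existsP) => [[H /and3P[/cyclicP[a defH] nHG cGH]] | [a [b [nag defG]]]].
  by have [b Gb defG] := cyclic_quotient_mulg nHG cGH; exists a, b; rewrite -defH.
exists <[a]>%G; rewrite /= cycle_cyclic nag /=.
exact: mulg_cyclic_quotient nag defG.
Qed.

Lemma conj_cycle_normal G a b : <[a]> <| G -> b \in G -> exists r, a ^ b = a ^+ r.
Proof.
move=> /andP[_ nG] Gb; apply/cycleP.
by rewrite memJ_norm ?cycle_id // (subsetP nG).
Qed.

Lemma cycle_expn_normal G a i : <[a]> <| G -> <[a ^+ i]> <| G.
Proof.
by apply: char_normal_trans; rewrite sub_cyclic_char ?cycle_cyclic // cycle_subG mem_cycle.
Qed.

Variable p : nat.
Hypotheses (p_pr : prime p) (p_gt2 : 2 < p).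

(** If b has order p^N, then r^(p^N) is 1 modulo [#[a]], hence modulo p; by Fermat it is also r
    modulo p. *)
Lemma pelt_conj_mod1 a b r :
  p.-elt a -> p.-elt b -> a != 1 -> a ^ b = a ^+ r -> r = 1 %[mod p].
Proof.
move=> pa pb a1 ab; have [N EN] := p_natP pb.
have [|_ pda _] := pgroup_pdiv pa; first by rewrite cycle_eq1.
have rN : r ^ (p ^ N) = r %[mod p].
  elim: (N) => [|k IHk]; first by rewrite expn1.
  by rewrite expnSr expnM fermat_little.
have: a ^+ (r ^ (p ^ N)) == a ^+ 1.
  by rewrite -(conjgX_expn _ ab) -EN expg_order conjg1 expg1.
by rewrite eq_expg_mod_order -rN => /eqP E; rewrite -(modn_dvdm _ pda) E modn_dvdm.
Qed.

(** Up to the unit u, taking p^n-th powers behaves as in an abelian group. *)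
Lemma expMg_pexp a b r i j n : r = 1 %[mod p] -> a ^ b = a ^+ r ->
  exists2 u, coprime p u &
    (b ^+ j * a ^+ i) ^+ (p ^ n) = b ^+ (j * p ^ n) * a ^+ (i * p ^ n * u).
Proof.
move=> r1 ab; have [u u1 E] := geo_pexp p_pr p_gt2 n (expn_mod1 j r1).
exists u; first by rewrite -coprime_modr u1 coprime_modr coprimen1.
by rewrite (expMg_geo _ _ (conjgX_expn j ab)) E -expgM mulnA.
Qed.

Lemma pelt_expg_coprime a i u :
  p.-elt a -> coprime p u -> (a ^+ (i * u) == 1) = (a ^+ i == 1).
Proof.
move=> pa pu; rewrite -!order_dvdn Gauss_dvdl //.
by have [N ->] := p_natP pa; rewrite coprimeXl.
Qed.

(** Write y = x^j a' with a' a power of a. Then [<[a']>] is normal and [<[x]> * <[a']>] contains x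
    and y, so it is G. By [expMg_pexp], a' is killed by p^n because x and y are, and then so is
    every x^s a'^t. *)
Lemma mulg_cycle_exponent G a x y n :
  p.-group G -> <[a]> <| G -> <[a]> * <[x]> = G -> <<[set x; y]>> = G ->
  x ^+ (p ^ n) = 1 -> y ^+ (p ^ n) = 1 -> {in G, forall g, g ^+ (p ^ n) = 1}.
Proof.
move=> pG nag defG genG.
have Gx : x \in G by rewrite -genG mem_gen // !inE eqxx.
have Gy : y \in G by rewrite -genG mem_gen // !inE eqxx orbT.
move=> xn yn; have [sag nG] := andP nag.
have nx : <[x]> \subset 'N(<[a]>) by rewrite cycle_subG (subsetP nG).
have: y \in <[x]> * <[a]> by rewrite normC // defG.
case/mulsgP=> [_ _ /cycleP[j ->] /cycleP[i ->] Ey].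
have nai := cycle_expn_normal i nag; move: (a ^+ i) nai Ey => a' nai Ey.
have [sai nGi] := andP nai.
have nxi : <[x]> \subset 'N(<[a']>) by rewrite cycle_subG (subsetP nGi).
have {}defG : <[x]> * <[a']> = G.
  apply/eqP; rewrite eqEsubset mul_subG ?cycle_subG //=; last by rewrite -cycle_subG.
  rewrite -norm_joinEl // -genG gen_subG; apply/subsetP=> z; rewrite !inE.
  have sx : x \in <[x]> <*> <[a']> by rewrite -cycle_subG joing_subl.
  case/orP=> /eqP-> //; rewrite Ey groupM ?groupX //.
  by rewrite /= -cycle_subG joing_subr.
have pa' : p.-elt a' by apply: mem_p_elt pG _; rewrite -cycle_subG.
have [r ar] := conj_cycle_normal nai Gx.
have [a1 | a1] := eqVneq a' 1.
  move=> g; rewrite -defG a1 cycle1 mulg1 => /cycleP[k ->].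
  by rewrite expgAC xn expg1n.
have r1 := pelt_conj_mod1 pa' (mem_p_elt pG Gx) a1 ar.
have an : a' ^+ (p ^ n) = 1.
  have [u pu] := expMg_pexp 1 j n r1 ar.
  rewrite expg1 -Ey yn mulnC expgM xn expg1n mul1g mul1n => /esym/eqP.
  by rewrite pelt_expg_coprime // => /eqP.
move=> g; rewrite -defG => /mulsgP[_ _ /cycleP[s ->] /cycleP[t ->] ->].
have [u pu ->] := expMg_pexp t s n r1 ar.
by rewrite mulnC expgM xn expg1n mul1g mulnAC mulnC expgM an expg1n.
Qed.

(** The quotient by the normal cyclic subgroup is a cyclic p-group, so x or y alone generates it and
    [mulg_cycle_exponent] applies. The exponent of a metacyclic group can thus be read off any pair
    of generators. *)
Lemma metacyclic_exponent G x y n :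
  p.-group G -> metacyclic G -> <<[set x; y]>> = G ->
  x ^+ (p ^ n) = 1 -> y ^+ (p ^ n) = 1 -> {in G, forall g, g ^+ (p ^ n) = 1}.
Proof.
move=> pG /metacyclic_mulgP[a [b [nag defG]]] genG xn yn; have [sag nG] := andP nag.
have Gx : x \in G by rewrite -genG mem_gen // !inE eqxx.
have Gy : y \in G by rewrite -genG mem_gen // !inE eqxx orbT.
have [|||defGx | defGy] := @cyclic_pgroup_gen2 p _ (G / <[a]>)%G (coset <[a]> x) (coset <[a]> y).
- exact: quotient_pgroup.
- exact: mulg_cyclic_quotient defG.
- have sub : [set x; y] \subset 'N(<[a]>).
    by rewrite -genG in nG; apply: subset_trans (subset_gen _) nG.
  rewrite /= -genG quotient_gen // quotientU !quotient_set1 //.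
    by apply: subsetP Gy.
  by apply: subsetP Gx.
- exact: mulg_cycle_exponent pG nag (quotient_cycle_mulg nag Gx (esym defGx)) genG xn yn.
rewrite setUC in genG.
exact: mulg_cycle_exponent pG nag (quotient_cycle_mulg nag Gy (esym defGy)) genG yn xn.
Qed.

End Metacyclic.

(** * Products of two cyclic p-groups *)

Section Huppert.

Variable p : nat.
Hypotheses (p_pr : prime p) (p_gt2 : 2 < p).

Lemma extract_pfactor i j : 0 < gcdn i j -> exists i' j' r,
  [/\ i = i' * p ^ r, j = j' * p ^ r & coprime p i' || coprime p j']%N.
Proof.
move=> g0; set r := logn p (gcdn i j).
have pr : p ^ r %| gcdn i j by rewrite pfactor_dvdnn.
have [/dvdnP[i' Ei] /dvdnP[j' Ej]] : p ^ r %| i /\ p ^ r %| j.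
  by apply/andP; rewrite -dvdn_gcd.
exists i', j', r; split=> //; rewrite !prime_coprime // -negb_and -dvdn_gcd.
apply/negP=> pg; suff: r.+1 <= r by rewrite ltnn.
rewrite -pfactor_dvdn // {1}Ei {1}Ej.
by rewrite -muln_gcdl expnS dvdn_pmul2r ?expn_gt0 ?prime_gt0.
Qed.

Lemma bicyclic_der1_prime (gT : finGroupType) (G : {group gT}) x y :
  p.-group G -> <[x]> * <[y]> = G -> #|G^`(1)| = p -> G^`(1) \subset 'Z(G) ->
  metacyclic G.
Proof.
move=> pG defG oG' sG'Z.
have Gx : x \in G by rewrite -cycle_subG -defG mulG_subl.
have Gy : y \in G by rewrite -cycle_subG -defG mulG_subr.
have /cyclicP[z defG'] : cyclic G^`(1) by rewrite prime_cyclic ?oG'.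
have z1 : z != 1 by rewrite -cycle_eq1 -defG' trivg_card1 oG' gtn_eqF ?prime_gt1.
have : z \in <[x]> * <[y]> by rewrite defG -cycle_subG -defG' der_sub.
case/mulsgP=> [_ _ /cycleP[i ->] /cycleP[j ->] Ez].
have g0 : 0 < gcdn i j.
  rewrite gcdn_gt0; apply: contraR z1; rewrite negb_or -!leqNgt !leqn0 Ez.
  by move=> /andP[/eqP-> /eqP->]; rewrite !expg0 mulg1.
have [i' [j' [r [Ei Ej cop]]]] := extract_pfactor g0.
pose c := x ^+ i' * y ^+ j'; have Gc : c \in G by rewrite groupM ?groupX.
pose w := [~ y ^+ j', x ^+ i'].
have G'w : w \in G^`(1) by rewrite derg1 mem_commg ?groupX.
have cw g : g \in G -> commute g w.
  by have /centerP[_ cGw] := subsetP sG'Z _ G'w => Gg; apply/commute_sym/cGw.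
have wp : w ^+ p = 1 by apply/eqP; rewrite -order_dvdn -oG' order_dvdG.
have Ec : c ^+ (p ^ r) = z.
  rewrite /c expMg_Rmul; try exact: cw (groupX _ _).
  rewrite -/w -!expgM -Ei -Ej -Ez.
  (* Since w is central, c^(p^r) differs from z by w to the power 'C(p^r, 2). For r > 0 this
     binomial is a multiple of the odd prime p, and for r = 0 it vanishes. *)
  suff /dvdnP[m ->] : p %| 'C(p ^ r, 2) by rewrite mulnC expgM wp expg1n mulg1.
  case: (r) => [|r']; first by rewrite expn0 bin_small.
  have podd : odd p by case: (even_prime p_pr) p_gt2 => // ->.
  by rewrite bin2odd ?oddX ?podd // expnS -mulnA dvdn_mulr.
have nc : <[c]> <| G.
  by rewrite sub_der1_normal ?cycle_subG // defG' cycle_subG -Ec mem_cycle.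
have [_ nGc] := andP nc.
have gen u m (H : {group gT}) : u \in G -> coprime p m -> u ^+ m \in H -> u \in H.
  move=> Gu pm um; rewrite -cycle_subG.
  have /eqP-> : generator <[u]> (u ^+ m).
    by have [k Ek] := p_natP (mem_p_elt pG Gu); rewrite generator_coprime Ek coprimeXl.
  by rewrite cycle_subG.
apply/metacyclic_mulgP.
(* If p does not divide i', take u = y: then x^i' = c y^(-j') lies in [<[c]> * <[y]>], hence so does
   x. Otherwise p does not divide j', and u = x works in the same way. *)
suff [u Gu [ux uy]] : exists2 u, u \in G & x \in <[c]> * <[u]> /\ y \in <[c]> * <[u]>.
  exists c, u; split=> //; apply/eqP; rewrite eqEsubset mul_subG ?cycle_subG //=.
  rewrite -defG -norm_joinEr ?cycle_subG ?(subsetP nGc) // in ux uy *.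
  by rewrite mul_subG ?cycle_subG.
have cc u : c \in <[c]> <*> <[u]> by rewrite -cycle_subG joing_subl.
have cu u : u \in <[c]> <*> <[u]> by rewrite -cycle_subG joing_subr.
case/orP: cop => [pi | pj]; [exists y | exists x];
  rewrite // -norm_joinEr ?cycle_subG ?(subsetP nGc) //; split=> //.
  apply: (gen x i') => //.
  by rewrite -(mulgK (y ^+ j') (x ^+ i')) groupMr ?groupV ?groupX ?cc ?cu.
apply: (gen y j') => //.
by rewrite -(mulKg (x ^+ i') (y ^+ j')) groupMl ?groupV ?groupX ?cc ?cu.
Qed.

Lemma eq_cycle_order (gT : finGroupType) (a u v : gT) :
  u \in <[a]> -> v \in <[a]> -> #[u] = #[v] -> <[u]> = <[v]>.
Proof.
rewrite -!cycle_subG => ua va uv; apply/eqP.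
by have /= -> := eq_subG_cyclic (cycle_cyclic a) ua va; apply/eqP.
Qed.

Theorem bicyclic_metacyclic (gT : finGroupType) (G : {group gT}) x y :
  p.-group G -> <[x]> * <[y]> = G -> metacyclic G.
Proof.
have [n] := ubnP #|G|; elim: n => // n IHn in gT G x y *; rewrite ltnS => leGn pG defG.
have [cGG | ncGG] := boolP (abelian G).
  apply/metacyclic_mulgP; exists x, y; split=> //.
  by rewrite -(sub_abelian_normal _ cGG) -defG mulG_subl.
have ntGZ : G^`(1) :&: 'Z(G) != 1.
  by rewrite meet_center_nil ?(pgroup_nil pG) ?der_normal // (sameP eqP derG1P).
have [_ pdGZ _] := pgroup_pdiv (pgroupS (subset_trans (subsetIl _ _) (der_sub 1 G)) pG) ntGZ.
have [z /setIP[G'z Zz] oz] := Cauchy p_pr pdGZ.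
pose N := <[z]>%G; have nNG : N <| G by rewrite sub_center_normal // cycle_subG.
have [sNG nG] := andP nNG.
have cz g : g \in G -> commute z g by have /centerP[_ cGz] := Zz; apply: cGz.
have /existsP[Kb /and3P[cKb nKb cGKb]] : metacyclic (G / N).
  apply: (IHn _ (G / N)%G (coset N x) (coset N y)).
  - apply: leq_trans leGn; rewrite ltn_quotient // cycle_eq1.
    by rewrite -order_eq1 oz gtn_eqF ?prime_gt1.
  - exact: quotient_pgroup.
  have nx : x \in 'N(N) by rewrite (subsetP nG) // -cycle_subG -defG mulG_subl.
  have ny : y \in 'N(N) by rewrite (subsetP nG) // -cycle_subG -defG mulG_subr.
  by rewrite -!quotient_cycle // -quotientMl ?cycle_subG // defG.
have [K defKb sNK nKG] := inv_quotientN nNG nKb.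
have [sKG nK] := andP nKG.
have [cK | ncK] := boolP (cyclic K).
  apply/existsP; exists K; rewrite cK nKG /=.
  by rewrite -(isog_cyclic (third_isog sNK nNG nKG)) -defKb.
have cGK : cyclic (G / K) by rewrite -(isog_cyclic (third_isog sNK nNG nKG)) -defKb.
have [b Gb defGK] := cyclic_quotient_mulg nKG cGK.
have [a Ka defK] : exists2 a, a \in K & N * <[a]> = K.
  by apply: cyclic_quotient_mulg; [apply: normalS nNG | rewrite -defKb].
have Ga := subsetP sKG a Ka.
have abK : abelian K.
  apply: cyclic_factor_abelian (_ : cyclic (K / N)); last by rewrite -defKb.
  rewrite subsetI sNK cycle_subG; apply/centP=> g Kg; apply: cz.
  exact: subsetP Kg.
have cKK u v : u \in K -> v \in K -> commute u v by move/(centsP abK); apply.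
pose c := [~ a, b]; have Kc : c \in K.
  by rewrite /c commgEl groupMl ?groupV // memJ_norm ?(subsetP nK).
(* As K is abelian and z is central, [k, b] is a power of c for every k in K. Since G = K [<[b]>],
   this makes [<[c]>] normal and equal to G'. *)
have commK k : k \in K -> [~ k, b] \in <[c]>.
  rewrite -defK => /mulsgP[_ _ /cycleP[s ->] /cycleP[t ->] ->].
  have /commgP/eqP zs : commute (z ^+ s) b by apply/commute_sym/commuteX/commute_sym/cz.
  rewrite commMgJ zs conj1g mul1g commXg ?mem_cycle //; exact: cKK.
have nc : <[c]> <| G.
  rewrite /normal cycle_subG (subsetP sKG) //= -defGK mul_subG //.
    by rewrite cents_norm // (subset_trans abK) // centS // cycle_subG.
  rewrite cycle_subG inE -genJ gen_subG conjg_set1 sub1set.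
  by rewrite -[c ^ b](mulKVg c) -commgEl groupM ?cycle_id ?commK.
have [_ nGc] := andP nc.
have defG' : G^`(1) = <[c]>.
  apply/eqP; rewrite eqEsubset cycle_subG derg1 mem_commg // andbT -derg1 der1_min //.
  rewrite -defGK quotientMl ?(subset_trans sKG) // abelianM quotient_abelian //=.
  rewrite quotient_abelian ?cycle_abelian //= quotient_cycle ?(subsetP nGc) // cycle_subG.
  apply/centP=> _ /morphimP[k Nk Kk ->]; apply/commute_sym/commgP.
  have Gk := subsetP sKG k Kk.
  apply/eqP; rewrite -morphR; try by apply: (subsetP nGc).
  exact: (@coset_id _ <[c]>%G _ (commK k Kk)).
have zc : z \in <[c]> by rewrite -defG'.
have pc : p.-elt c by apply: mem_p_elt pG (subsetP sKG _ Kc).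
have [cp | cp] := eqVneq (c ^+ p) 1.
  have oc : #[c] = p.
    apply: nt_prime_order => //; apply: contraNneq ncGG => c1.
    by rewrite (sameP derG1P eqP) defG' c1 cycle1.
  apply: (bicyclic_der1_prime pG defG); first by rewrite defG'.
  rewrite defG'; suff <- : <[z]> = <[c]> by rewrite cycle_subG.
  by apply: (eq_cycle_order zc (cycle_id c)); rewrite oz oc.
(* With c = z^s a^i and z central of order p, c^p = a^(ip) lies in [<[a]>]. It is nontrivial, so its
   powers include the unique subgroup of order p of [<[c]>], which is N. Hence K = N [<[a]>] =
   [<[a]>]. *)
case/negP: ncK.
have: c \in N * <[a]> by rewrite defK.
case/mulsgP=> _ _ /cycleP[s ->] /cycleP[i ->] Ec.
have cpa : c ^+ p \in <[a]>.
  rewrite Ec expgMn; last by apply: cKK; rewrite groupX // (subsetP sNK) ?cycle_id.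
  by rewrite expgAC -oz expg_order expg1n mul1g groupX ?mem_cycle.
have za : z \in <[a]>.
  have pcp : p.-elt (c ^+ p) by rewrite p_eltX.
  have [|_ pdc _] := pgroup_pdiv pcp; first by rewrite cycle_eq1.
  have [w cpw ow] := Cauchy p_pr pdc.
  suff E : <[z]> = <[w]>.
    by rewrite -cycle_subG E cycle_subG; apply: subsetP cpw; rewrite cycle_subG.
  apply: (eq_cycle_order zc); last by rewrite oz ow.
  by apply: subsetP cpw; rewrite cycle_subG mem_cycle.
suff ->: K = <[a]>%G by apply: cycle_cyclic.
by apply/val_inj; rewrite /= -defK mulSGid ?cycle_subG.
Qed.

End Huppert.

(** * Metacyclic presentations *)

(** Only the relations are required, so G may be a proper quotient of the presented group. Fullness
    is expressed separately by the order p^(h+k). Taking l = h encodes b^(p^k) = 1. *)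
Definition metacyclic_gen (p h k l f : nat) (gT : finGroupType) (G : {group gT}) a b :=
  [/\ <[a]> <*> <[b]> = G, a ^+ (p ^ h) = 1, b ^+ (p ^ k) = a ^+ (p ^ l)
    & a ^ b = a ^+ (1 + p ^ f)].

Section MetacyclicGen.

Variables (p h k l f : nat) (gT : finGroupType) (G : {group gT}) (a b : gT).
Hypothesis p_pr : prime p.
Hypothesis genG : metacyclic_gen p h k l f G a b.

Let p_gt1 : 1 < p. Proof. exact: prime_gt1. Qed.

Lemma metacyclic_gen_in : a \in G /\ b \in G.
Proof. by case: genG => <- _ _ _; rewrite -!cycle_subG joing_subl joing_subr. Qed.

Let Ga : a \in G := proj1 metacyclic_gen_in.
Let Gb : b \in G := proj2 metacyclic_gen_in.

Lemma metacyclic_gen_normal : <[a]> <| G.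
Proof.
case: genG => defG _ _ ab; rewrite /normal cycle_subG Ga -defG join_subG normG.
by rewrite cycle_subG inE -genJ gen_subG conjg_set1 sub1set ab mem_cycle.
Qed.

Let nG : G \subset 'N(<[a]>). Proof. by case/andP: metacyclic_gen_normal. Qed.
Let nb : b \in 'N(<[a]>). Proof. exact: subsetP Gb. Qed.

Lemma metacyclic_gen_mulg : <[a]> * <[b]> = G.
Proof. by case: genG => <- _ _ _; rewrite norm_joinEr // cycle_subG. Qed.

Lemma metacyclic_gen_orders :
  [/\ #[a] %| p ^ h, #[coset <[a]> b] %| p ^ k & #|G| = #[a] * #[coset <[a]> b]]%N.
Proof.
have [_ ah bk _] := genG; split; first by rewrite order_dvdn ah.
  by rewrite order_dvdn -morphX //= bk; apply/eqP/coset_id/mem_cycle.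
rewrite -[LHS](LagrangeI G <[a]>) (setIidPr _) ?cycle_subG //; congr (_ * _)%N.
rewrite -card_quotient // -metacyclic_gen_mulg quotientMidl.
by rewrite quotient_cycle.
Qed.

Lemma card_metacyclic_gen_dvdn : #|G| %| p ^ (h + k).
Proof.
by have [ah bk ->] := metacyclic_gen_orders; rewrite expnD dvdn_mul.
Qed.

Hypothesis oG : #|G| = (p ^ (h + k))%N.

Lemma metacyclic_gen_pgroup : p.-group G.
Proof. by rewrite /pgroup oG pnatX pnat_id. Qed.

(** The two orders divide p^h and p^k and their product is p^(h+k), so neither can be smaller. *)
Lemma order_metacyclic_gen : #[a] = (p ^ h)%N /\ #[coset <[a]> b] = (p ^ k)%N.
Proof.
have [ah bk E] := metacyclic_gen_orders; rewrite oG expnD in E.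
have := dvdn_leq (_ : 0 < p ^ h) ah; have := dvdn_leq (_ : 0 < p ^ k) bk.
rewrite !expn_gt0 prime_gt0 //=.
move: (p ^ h)%N (p ^ k)%N E (order_gt0 a) (order_gt0 (coset <[a]> b)).
by move=> P Q; move: #[_] #[_] => x y E x0 y0 /(_ isT) xP /(_ isT) yQ; split; nia.
Qed.

Let oa : #[a] = (p ^ h)%N := proj1 order_metacyclic_gen.

Lemma expg_metacyclic_gen1 n : (a ^+ (p ^ n) == 1) = (h <= n).
Proof. by rewrite -order_dvdn oa dvdn_Pexp2l. Qed.

Lemma expg_metacyclic_gen2_in n : (b ^+ (p ^ n) \in <[a]>) = (k <= n).
Proof.
have [_ ob] := order_metacyclic_gen.
rewrite -(dvdn_Pexp2l _ _ p_gt1) -ob order_dvdn -morphX //=.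
by apply/idP/eqP; [apply: coset_id | apply: coset_idr; rewrite groupX].
Qed.

Lemma expg_metacyclic_gen2 n : l <= h -> (b ^+ (p ^ n) == 1) = (k + (h - l) <= n).
Proof.
move=> lh; have [kn | nk] := leqP k n; last first.
  apply/idP/idP=> [/eqP bn|]; last by lia.
  by have := expg_metacyclic_gen2_in n; rewrite bn group1; lia.
have [_ _ bk _] := genG.
rewrite -{1}(subnKC kn) expnD expgM bk -expgM -expnD expg_metacyclic_gen1; lia.
Qed.

Lemma metacyclic_gen_metacyclic : metacyclic G.
Proof.
apply/metacyclic_mulgP; exists a, b.
by split; [apply: metacyclic_gen_normal | apply: metacyclic_gen_mulg].
Qed.

Lemma metacyclic_gen_exponent n : 2 < p -> l <= h ->
  {in G, forall g, g ^+ (p ^ n) = 1} <-> maxn h (k + (h - l)) <= n.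
Proof.
move=> p_gt2 lh; rewrite geq_max; split=> [G1 | /andP[hn kn]].
  by rewrite -expg_metacyclic_gen1 G1 // -expg_metacyclic_gen2 // G1 // !eqxx.
apply: (metacyclic_exponent p_pr p_gt2 metacyclic_gen_pgroup metacyclic_gen_metacyclic).
- by have [<- _ _ _] := genG; rewrite joing_idl joing_idr.
- by apply/eqP; rewrite expg_metacyclic_gen1.
by apply/eqP; rewrite expg_metacyclic_gen2.
Qed.

Lemma metacyclic_gen_der1 : G^`(1) = <[a ^+ (p ^ f)]>.
Proof.
have [_ _ _ ab] := genG.
have Eab : [~ a, b] = a ^+ (p ^ f) by rewrite commgEl ab expgD expg1 mulKg.
have nf := cycle_expn_normal (p ^ f) metacyclic_gen_normal.
have [_ nGf] := andP nf.
apply/eqP; rewrite eqEsubset cycle_subG -Eab derg1 mem_commg // andbT -derg1 Eab.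
rewrite der1_min // -metacyclic_gen_mulg.
have Na : a \in 'N(<[a ^+ (p ^ f)]>) by apply: subsetP Ga.
have Nb : b \in 'N(<[a ^+ (p ^ f)]>) by apply: subsetP Gb.
rewrite quotientMl ?cycle_subG // abelianM !quotient_abelian ?cycle_abelian //=.
rewrite !quotient_cycle // cent_cycle cycle_subG; apply/cent1P/commute_sym/commgP/eqP.
by rewrite -morphR //; apply: (@coset_id _ <[_]>%G); rewrite Eab cycle_id.
Qed.

Lemma order_metacyclic_genX n : n <= h -> #[a ^+ (p ^ n)] = (p ^ (h - n))%N.
Proof. by move=> nh; rewrite orderXdiv oa ?dvdn_exp2l // expnB ?prime_gt0. Qed.

Lemma card_metacyclic_gen_der1 : f <= h -> #|G^`(1)| = (p ^ (h - f))%N.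
Proof.
by move=> fh; rewrite metacyclic_gen_der1 -orderE order_metacyclic_genX.
Qed.

(** G/G' is abelian, generated by the images of a, of order p^f, and of b. As f <= l, b^(p^k) =
    a^(p^l) lies in G', and G' lies in [<[a]>], so b has order exactly p^k modulo G'. *)
Lemma metacyclic_gen_quotient_exponent n : f <= h -> f <= l ->
  {in G, forall g, g ^+ (p ^ n) \in G^`(1)} <-> maxn f k <= n.
Proof.
move=> fh fl; rewrite geq_max; have sG' := metacyclic_gen_der1; split=> [G1 | /andP[fn kn]].
  apply/andP; split.
    have := G1 a Ga; rewrite sG' -cycle_subG => /cardSg; rewrite -!orderE.
    have [hn | nh] := leqP h n; first by lia.
    by rewrite !order_metacyclic_genX ?(ltnW nh) // dvdn_Pexp2l //; lia.
  rewrite -expg_metacyclic_gen2_in; have := G1 b Gb; rewrite sG'.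
  by apply: subsetP; rewrite cycle_subG mem_cycle.
have nG' : G \subset 'N(G^`(1)) := der_norm 1 G.
have abG : abelian (G / G^`(1)) := der_abelian 0 G.
have Gf m : f <= m -> a ^+ (p ^ m) \in G^`(1).
  by move=> fm; rewrite sG' -(subnKC fm) expnD expgM mem_cycle.
have [_ _ bk _] := genG.
have bn : b ^+ (p ^ n) \in G^`(1).
  by rewrite -(subnKC kn) expnD expgM bk groupX ?Gf.
move=> g Gg; have: g \in <[a]> * <[b]> by rewrite metacyclic_gen_mulg.
case/mulsgP=> _ _ /cycleP[i ->] /cycleP[j ->] Eg.
apply: coset_idr; first by apply: (subsetP nG'); rewrite groupX.
have Na : a \in 'N(G^`(1)) by apply: subsetP Ga.
have Nb : b \in 'N(G^`(1)) by apply: subsetP Gb.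
rewrite Eg morphX ?morphM ?groupM ?groupX //= expgMn; last first.
  by apply: (centsP abG); rewrite mem_quotient ?groupX.
have key u m : u \in 'N(G^`(1)) -> u ^+ (p ^ n) \in G^`(1) ->
    coset G^`(1) (u ^+ m) ^+ (p ^ n) = 1.
  by move=> Nu un; rewrite -morphX ?groupX //= expgAC; apply: coset_id; rewrite groupX.
by rewrite !key ?mulg1 ?Gf.
Qed.

End MetacyclicGen.

(** This supplies the action for the semidirect product from which the model groups are built. *)
Lemma exists_expn_aut (gT : finGroupType) (c : gT) e n :
  coprime #[c] e -> e ^ n = 1 %[mod #[c]] ->
  exists s, [/\ s \in Aut <[c]>, #[s] %| n & s c = c ^+ e].
Proof.
move=> co en.
have inj : 'injm (cyclem e c).
  apply/injmP=> u v cu cv /= E; apply/eqP; rewrite eq_mulgV1 -order_eq1 -dvdn1.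
  have cuv : u * v^-1 \in <[c]> by rewrite groupM ?groupV.
  rewrite -(eqP (coprime_dvdl (order_dvdG cuv) co)) dvdn_gcd dvdnn order_dvdn.
  rewrite expgMn ?expgVn; first by rewrite -eq_mulgV1; apply/eqP.
  by apply: (centsP (cycle_abelian c)); rewrite ?groupV.
have im : cyclem e c @* <[c]> = <[c]>.
  rewrite morphim_cycle ?cycle_id //; apply/esym/eqP.
  by rewrite -/(generator _ _) generator_coprime.
exists (aut inj im); split; first exact: Aut_aut.
  rewrite order_dvdn; apply/eqP; apply: (eq_Aut (groupX _ (Aut_aut inj im)) (group1 _)).
  have sX m u : u \in <[c]> -> (aut inj im ^+ m) u = u ^+ (e ^ m).
    move=> cu; elim: m => [|m IHm]; first by rewrite perm1.
    by rewrite expgSr permM IHm autE ?groupX //= /cyclem -expgM expnSr.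
  have /eqP E : c ^+ (e ^ n) == c ^+ 1 by rewrite eq_expg_mod_order en.
  by move=> u cu; rewrite sX // perm1; case/cycleP: cu => i ->; rewrite expgAC E.
by rewrite autE ?cycle_id.
Qed.

(* The pairs (a', a) and (b', b) generate a subgroup of H x M that satisfies the
   relations, so has at most the order of M, and thus projects isomorphically to M. *)
Lemma metacyclic_gen_homg p h k l f (gT rT : finGroupType) (M : {group gT})
    (H : {group rT}) a b a' b' :
  prime p -> #|M| = (p ^ (h + k))%N ->
  metacyclic_gen p h k l f M a b -> metacyclic_gen p h k l f H a' b' -> H \homg M.
Proof.
move=> p_pr oM [defM ah bk ab] [defH ah' bk' ab'].
pose D := (<[(a', a)]> <*> <[(b', b)]>)%G.
have pX u v n : (u, v) ^+ n = (u ^+ n, v ^+ n) :> rT * gT.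
  by elim: n => // n IHn; rewrite !expgS IHn.
have genD : metacyclic_gen p h k l f D (a', a) (b', b).
  split; rewrite ?pX ?ah ?ah' ?bk ?bk' //=.
  by rewrite -ab -ab'.
have DM : snd @* D = M by rewrite morphimY ?morphim_cycle ?inE ?subsetT.
have DH : fst @* D = H by rewrite morphimY ?morphim_cycle ?inE ?subsetT.
have isoMD : M \isog D.
  rewrite isogEcard; apply/andP; split; first by rewrite -DM; apply: morphim_homg.
  by rewrite oM dvdn_leq ?expn_gt0 ?prime_gt0 // (card_metacyclic_gen_dvdn genD).
rewrite (eq_homgr _ isoMD) -DH; exact: morphim_homg.
Qed.

(** * Construction of a metacyclic group of full order *)

Section Model.

Variables p h k l f : nat.
Hypotheses (p_pr : prime p) (p_gt2 : 2 < p).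
Hypotheses (h_gt0 : 0 < h) (k_gt0 : 0 < k) (f_gt0 : 0 < f).
Hypotheses (lh : l <= h) (hfl : h <= f + l) (hfk : h <= f + k).

(** Let y of order p^N, the order that b must have, act on x of order p^h by the power 1 + p^f. In
    this semidirect product h <= f + k makes y^(p^k) commute with x, and h <= f + l makes x^(p^l)
    commute with y, so w = y^(p^k) x^(-p^l) is central. Its order divides p^(h-l), so the quotient
    by [<[w]>] has order at least p^(h+k), and the relations give the opposite bound. *)
Lemma metacyclic_gen_model : exists (gT : finGroupType) (M : {group gT}) a b,
  #|M| = (p ^ (h + k))%N /\ metacyclic_gen p h k l f M a b.
Proof.
pose N := (k + (h - l))%N; have p_gt1 := prime_gt1 p_pr.
have ph : 1 < p ^ h by rewrite -(exp1n h) ltn_exp2r.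
have pN : 1 < p ^ N by rewrite -(exp1n N) ltn_exp2r // addn_gt0 k_gt0.
have pow n : h <= f + n -> (1 + p ^ f) ^ (p ^ n) = 1 %[mod p ^ h].
  move=> hfn; have [u _] := expn_pexp p_pr p_gt2 1 n f_gt0.
  by rewrite !mul1n => ->; rewrite -(subnKC hfn) expnD mulnCA -modnDmr modnMr.
have oZ : #[Zp1 : 'Z_(p ^ h)] = (p ^ h)%N by rewrite order_Zp1 Zp_cast.
have [s sP] : exists s, [/\ s \in Aut <[Zp1 : 'Z_(p ^ h)]>, #[s] %| p ^ N
    & s Zp1 = Zp1 ^+ (1 + p ^ f)].
  apply: exists_expn_aut; rewrite oZ ?pow //; last by rewrite /N; lia.
  rewrite coprimeXl // -coprime_modr; have := mod1_pexp p 1 f_gt0.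
  by rewrite mul1n => ->; rewrite coprime_modr coprimen1.
have oS := Extremal.card (1 + p ^ f) pN ph.
have /isoGrp_hom/existsP[[x y]] := Extremal.Grp pN ph (ex_intro _ s sP).
set S := [set: _]%G in oS * => /eqP[defS xh yN xy].
pose u := y ^+ (p ^ k); pose v := x ^+ (p ^ l); pose w := u * v^-1.
have /eqP xpow : x ^+ ((1 + p ^ f) ^ (p ^ k)) == x ^+ 1.
  have xh' : #[x] %| p ^ h by rewrite order_dvdn xh.
  by rewrite eq_expg_mod_order -(modn_dvdm _ xh') pow // modn_dvdm.
have cxu : commute x u by apply/commgP/conjg_fixP; rewrite (conjgX_expn _ xy) xpow.
have cyv : commute y v.
  apply/commute_sym/commgP/conjg_fixP; rewrite conjXg xy -expgM mulnDl mul1n -expnD expgD.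
  by rewrite -(subnKC hfl) expnD expgM xh expg1n mulg1.
have cxv : commute x v by apply: commuteX.
have cyu : commute y u by apply: commuteX.
have cuv : commute u v by apply/commute_sym/commuteX/commute_sym.
have sWZ : <[w]> \subset 'Z(S).
  rewrite subsetI subsetT cycle_subG.
  have: w \in 'C(<[x]> <*> <[y]>).
    rewrite centY inE !cent_cycle.
    by apply/andP; split; apply/cent1P/commute_sym/commuteM => //; apply: commuteV.
  by rewrite defS.
have nWS : <[w]> <| S := sub_center_normal sWZ.
have [_ nW] := andP nWS.
have ow : #[w] %| p ^ (h - l).
  rewrite order_dvdn expgMn; last exact/commuteV.
  rewrite expgVn -!expgM -!expnD -/N subnKC // xh yN invg1 mulg1 //.
have Nx : x \in 'N(<[w]>) by apply: (subsetP nW); rewrite inE.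
have Ny : y \in 'N(<[w]>) by apply: (subsetP nW); rewrite inE.
have genM : metacyclic_gen p h k l f (S / <[w]>)%G (coset <[w]> x) (coset <[w]> y).
  split; rewrite -?morphX -?morphJ //= ?xh ?xy ?morph1 //.
    by rewrite -!quotient_cycle // -quotientY ?cycle_subG // defS.
  by apply/rcoset_kercosetP; rewrite ?groupX // mem_rcoset cycle_id.
exists _, (S / <[w]>)%G, (coset <[w]> x), (coset <[w]> y); split=> //.
apply/eqP; rewrite eqn_leq dvdn_leq ?expn_gt0 ?prime_gt0 //=; last first.
  exact: card_metacyclic_gen_dvdn genM.
rewrite card_quotient // -divgS ?subsetT // leq_divRL ?cardG_gt0 //.
rewrite oS mulnC (leq_trans (leq_mul (dvdn_leq _ ow) (leqnn _))) ?expn_gt0 ?prime_gt0 //.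
by rewrite -!expnD leq_exp2l // /N; lia.
Qed.

End Model.

(** * Normal form of a metacyclic p-group *)

Section NormalForm.

Variable p : nat.
Hypotheses (p_pr : prime p) (p_gt2 : 2 < p).

Let p_gt1 : 1 < p. Proof. exact: prime_gt1. Qed.

(** The conditions of the model are necessary: b commutes with its power a^(p^l), which yields h <=
    f + l, and a commutes with b^(p^k), a power of a, which yields h <= f + k. *)
Lemma metacyclic_gen_bounds h k l f (gT : finGroupType) (G : {group gT}) a b :
  metacyclic_gen p h k l f G a b -> #|G| = (p ^ (h + k))%N -> 0 < f ->
  h <= f + l /\ h <= f + k.
Proof.
move=> genG oG f_gt0; have [_ _ bk ab] := genG.
have pa : p.-elt a.
  exact: mem_p_elt (metacyclic_gen_pgroup p_pr oG) (proj1 (metacyclic_gen_in genG)).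
split; rewrite -(expg_metacyclic_gen1 p_pr genG oG).
  have: (a ^+ (p ^ l)) ^ b = a ^+ (p ^ l).
    by rewrite -bk; apply/conjg_fixP/commgP/commute_sym/commuteX.
  rewrite conjXg ab -expgM mulnDl mul1n expgD -expnD.
  by move/eqP; rewrite -[X in _ == X]mulg1 (inj_eq (mulgI _)).
have [u u1 E] := expn_pexp p_pr p_gt2 1 k f_gt0; rewrite !mul1n in E.
have: a ^ (b ^+ (p ^ k)) = a.
  by rewrite bk; apply/conjg_fixP/commgP/commuteX.
have pu : coprime p u by rewrite -coprime_modr u1 coprime_modr coprimen1.
rewrite (conjgX_expn _ ab) E expgD expg1 mulnC -(pelt_expg_coprime _ pa pu).
by move/eqP; rewrite -[X in _ == X]mulg1 (inj_eq (mulgI _)).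
Qed.

Lemma cycle_expg_coprime (gT : finGroupType) (x : gT) t :
  p.-elt x -> coprime p t -> <[x ^+ t]> = <[x]>.
Proof.
move=> px pt; apply/esym/eqP; rewrite -/(generator _ _) generator_coprime.
by have [n ->] := p_natP px; rewrite coprimeXl.
Qed.

(** A trivial action corresponds to f = h. Otherwise r = 1 + s p^f with s prime to p, and
    [exists_expn_mod] gives the power of b that acts by 1 + p^f. *)
Lemma exists_conj_pow (gT : finGroupType) (a b : gT) h r :
  #[a] = (p ^ h)%N -> p.-elt b -> a ^ b = a ^+ r -> exists t f,
  [/\ coprime p t, f <= h, 0 < h -> 0 < f & a ^ (b ^+ t) = a ^+ (1 + p ^ f)].
Proof.
move=> oa pb ab; have pa : p.-elt a by rewrite /p_elt oa pnatX pnat_id.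
have ah : a ^+ (p ^ h) = 1 by rewrite -oa expg_order.
have [rh | rh] := eqVneq (a ^+ r) a.
  by exists 1%N, h; rewrite coprimen1 expg1 ab rh expgD ah mulg1 expg1.
have a1 : a != 1 by apply: contraNneq rh => ->; rewrite expg1n.
have r1 := pelt_conj_mod1 p_pr pa pb a1 ab.
have r0 : 0 < r := mod1_gt0 p_gt1 r1.
have m0 : 0 < r - 1.
  by rewrite subn_gt0 ltn_neqAle r0 andbT; apply: contraNneq rh => <-; rewrite expg1.
have [s ps Em] := pfactor_coprime p_pr m0; set f := logn p (r - 1) in Em.
have Er : r = (1 + s * p ^ f)%N by rewrite -Em subnKC.
have f0 : 0 < f by rewrite logn_gt0 mem_primes p_pr m0 -eqn_mod_dvd // r1 eqxx.
have fh : f <= h.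
  rewrite leqNgt; apply: contraNN rh => hf.
  by rewrite Er -(subnKC (ltnW hf)) expnD mulnCA expgD expgM ah expg1n mulg1 expg1.
have [t pt Et] := exists_expn_mod p_pr p_gt2 h f0 ps.
exists t, f; split=> //; rewrite (conjgX_expn _ ab); apply/eqP.
by rewrite eq_expg_mod_order oa Er Et.
Qed.

(** First b is replaced by a power that acts by 1 + p^f. Then b^(p^k) = a0^(u p^l) with u prime to
    p, and a = a0^u absorbs u without changing the action. *)
Lemma metacyclic_gen_exists (gT : finGroupType) (G : {group gT}) a0 :
  p.-group G -> <[a0]> <| G -> cyclic (G / <[a0]>) ->
  exists h k l f a b, [/\ <[a]> = <[a0]>, metacyclic_gen p h k l f G a b,
    #|G| = (p ^ (h + k))%N, f <= h /\ l <= h & 0 < h -> 0 < f].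
Proof.
move=> pG na cGa; have [b0 Gb0 defG] := cyclic_quotient_mulg na cGa.
have [sa nG] := andP na; have Ga0 : a0 \in G by rewrite -cycle_subG.
have [h oa] := p_natP (mem_p_elt pG Ga0).
have [r ab] := conj_cycle_normal na Gb0.
have [t [f [pt fh hf]]] := exists_conj_pow oa (mem_p_elt pG Gb0) ab.
have Eb := cycle_expg_coprime (mem_p_elt pG Gb0) pt.
set b := b0 ^+ t in Eb * => abt; have Gb : b \in G by rewrite groupX.
rewrite -Eb in defG.
have [k oGa] := p_natP (quotient_pgroup <[a0]> pG : p.-nat #|G / <[a0]>|).
have oG : #|G| = (p ^ (h + k))%N.
  by rewrite expnD -oa -oGa card_quotient // Lagrange.
have : b ^+ (p ^ k) \in <[a0]>.
  apply: coset_idr; first by apply: (subsetP nG); rewrite groupX.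
  rewrite morphX ?(subsetP nG) // -oGa; apply/eqP.
  by rewrite -order_dvdn order_dvdG // mem_quotient.
case/cycleP=> i Ei.
have nb : <[b]> \subset 'N(<[a0]>) by rewrite cycle_subG (subsetP nG).
have ah : a0 ^+ (p ^ h) = 1 by rewrite -oa expg_order.
have [i1 | i1] := eqVneq (a0 ^+ i) 1.
  exists h, k, h, f, a0, b; split=> //; split=> //; first by rewrite norm_joinEr.
  by rewrite Ei i1.
have i0 : 0 < i by case: (i) i1; rewrite ?eqxx.
have [u pu Eiu] := pfactor_coprime p_pr i0; set l := logn p i in Eiu.
have Ea := cycle_expg_coprime (mem_p_elt pG Ga0) pu.
exists h, k, l, f, (a0 ^+ u), b; split=> //.
  split; first by rewrite Ea norm_joinEr.
  - by rewrite expgAC ah expg1n.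
  - by rewrite Ei Eiu expgM.
  by rewrite conjXg abt expgAC.
split=> //; rewrite leqNgt; apply: contraNN i1 => hl.
by rewrite Eiu -(subnKC (ltnW hl)) expnD mulnCA expgM ah expg1n.
Qed.

(** For b' = b a^(t p^(l-k)) the p^k-th power is a^(p^l (1 + t u)) with u prime to p, so it is
    enough that t u = -1 modulo p^h. *)
Lemma metacyclic_gen_split h k l f (gT : finGroupType) (G : {group gT}) a b :
  p.-group G -> metacyclic_gen p h k l f G a b -> (0 < h -> 0 < f) -> k <= l <= h ->
  exists b', metacyclic_gen p h k h f G a b'.
Proof.
move=> pG genG hf /andP[kl lh]; have [defG ah bk ab] := genG.
have [h0 | h0] := posnP h.
  have Elh : l = h by lia.
  by exists b; rewrite Elh in genG.
have [Ga Gb] := metacyclic_gen_in genG.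
have r1 := mod1_pexp p 1 (hf h0); rewrite mul1n in r1.
have [u pu E] : exists2 u, coprime p u & forall j,
    (b * a ^+ j) ^+ (p ^ k) = b ^+ (p ^ k) * a ^+ (j * p ^ k * u).
  have [u u1 E] := geo_pexp p_pr p_gt2 k r1.
  exists u; first by rewrite -coprime_modr u1 coprime_modr coprimen1.
  by move=> j; rewrite (expMg_geo _ _ ab) E mulnA.
have ph : 1 < p ^ h by rewrite -(exp1n h) ltn_exp2r.
have [t Et] : exists t, t * u = p ^ h - 1 %[mod p ^ h].
  by apply: modular_inverse; rewrite // coprimeXl.
exists (b * a ^+ (t * p ^ (l - k))); split=> //.
- rewrite -defG; apply/eqP; rewrite eqEsubset !join_subG !joing_subl !cycle_subG.
  have sa (c : gT) : a \in <[a]> <*> <[c]> by rewrite -cycle_subG joing_subl.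
  have sb (c : gT) : c \in <[a]> <*> <[c]> by rewrite -cycle_subG joing_subr.
  rewrite groupM ?groupX ?sa ?sb //=.
  by rewrite -[X in X \in _](mulgK (a ^+ (t * p ^ (l - k)))) groupM ?groupV ?groupX ?sa ?sb.
- rewrite E bk -expgD ah; apply/eqP; rewrite -order_dvdn.
  have -> : (p ^ l + t * p ^ (l - k) * p ^ k * u = p ^ l * (t * u + 1))%N.
    by rewrite -{1 3}(subnK kl) expnD; lia.
  apply: dvdn_mull; apply: (@dvdn_trans (p ^ h)); first by rewrite order_dvdn ah.
  by rewrite /dvdn -modnDml Et modnDml subnK ?modnn // ltnW.
by rewrite conjgM ab; apply/conjg_fixP/commgP/commuteX/commute_sym/commuteX.
Qed.

Lemma metacyclic_normal_form (gT : finGroupType) (G : {group gT}) :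
  p.-group G -> metacyclic G ->
  exists h k l f a b, [/\ metacyclic_gen p h k l f G a b,
    #|G| = (p ^ (h + k))%N, f <= h /\ l <= h, 0 < h -> 0 < f &
    l = h /\ k <= h \/ f < l < k].
Proof.
move=> pG /existsP[H0 PH0].
case: (@arg_maxnP _ H0 (fun H : {group gT} => [&& cyclic H, H <| G & cyclic (G / H)])
  (fun H => #|H|) PH0) => H /and3P[/cyclicP[a0 defH] nH cGH] maxH.
rewrite defH in nH cGH.
have [h [k [l [f [a [b [Ea genG oG [fh lh] hf]]]]]]] := metacyclic_gen_exists pG nH cGH.
have [kl | lk] := leqP k l.
  have [b' genG'] := metacyclic_gen_split pG genG hf (introT andP (conj kl lh)).
  by exists h, k, h, f, a, b'; split=> //; left; split=> //; lia.
exists h, k, l, f, a, b; split=> //; right; rewrite lk andbT ltnNge; apply/negP=> lf.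
have [defG ah bk ab] := genG; have [Ga Gb] := metacyclic_gen_in genG.
(* From l <= f, the commutator a^(p^f) of a and b is a power of a^(p^l) = b^(p^k). Hence [<[b]>] is
   normal with cyclic quotient, while its order p^(k+h-l) exceeds p^h. *)
have pb : a ^+ (p ^ f) \in <[b]>.
  by rewrite -(subnKC lf) expnD expgM -bk -expgM mem_cycle.
have defG' := metacyclic_gen_mulg genG.
have nb : <[b]> <| G.
  rewrite /normal cycle_subG Gb -defG join_subG normG andbT.
  rewrite cycle_subG inE -genJ gen_subG conjg_set1 sub1set.
  rewrite -[b ^ a](mulKVg b) -commgEl groupM ?cycle_id // -invg_comm groupV commgEl ab.
  by rewrite expgD expg1 mulKg.
have defGb : <[b]> * <[a]> = G.
  by rewrite normC // cycle_subG (subsetP (normal_norm (metacyclic_gen_normal genG))).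
have [n ob] := p_natP (mem_p_elt pG Gb).
have := maxH <[b]>%G; rewrite /= cycle_cyclic nb (mulg_cyclic_quotient nb defGb) => /(_ isT).
rewrite defH -Ea -!orderE ob (proj1 (order_metacyclic_gen p_pr genG oG)) leq_exp2l //.
have := expg_metacyclic_gen2 p_pr genG oG n lh.
by rewrite -ob expg_order eqxx; clear -lk lh; lia.
Qed.

End NormalForm.

(** * The listed groups *)

(* The exponents (h, k, l, f) for which the listed group has the presentation
   a^(p^h) = 1, b^(p^k) = a^(p^l), a^b = a^(1 + p^f). *)
Definition listed_params (t : listed_group) : nat * nat * nat * nat :=
  match t with
  | M1 d e f => (e, d, e, f)
  | M2 d e f => (d, e, d, f)
  | M3 d e h f => (h, d + e - h, d, f)%N
  end.

Section Presentations.

Variable p : nat.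
Hypotheses (p_pr : prime p) (p_gt2 : 2 < p).

(** The notation for presentations says that the homomorphic images of G are exactly the groups with
    generators satisfying the relations. This puts the three families under the single predicate
    [metacyclic_gen]. *)
Lemma presented_by_homg t h k l f (gT : finGroupType) (G : {group gT}) :
  listed_params t = (h, k, l, f) ->
  presented_by p t G <-> (forall (rT : finGroupType) (H : {group rT}),
    H \homg G <-> exists a b, metacyclic_gen p h k l f H a b).
Proof.
suff homP : listed_params t = (h, k, l, f) -> presented_by p t G <->
    (forall (rT : finGroupType) (H : {group rT}),
      (H \homg G) = [exists v : rT * rT, [&& <[v.1]> <*> <[v.2]> == H, v.1 ^+ (p ^ h) == 1,
        v.2 ^+ (p ^ k) == v.1 ^+ (p ^ l) & v.1 ^ v.2 == v.1 ^+ (1 + p ^ f)]]).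
  move=> tE; rewrite (homP tE); split=> GH rT H.
    rewrite GH; split=> [/existsP[[a b] /= /and4P[/eqP ? /eqP ? /eqP ? /eqP ?]] | ].
      by exists a, b.
    case=> a [b [? ah bk ab]]; apply/existsP; exists (a, b).
    by rewrite /= ah bk ab !eqxx !andbT; apply/eqP.
  apply/idP/existsP=> [/GH[a [b [E ah bk ab]]] | [[a b] /= /and4P[/eqP ? /eqP ? /eqP ? /eqP ?]]].
    by exists (a, b); rewrite /= ah bk ab !eqxx !andbT; apply/eqP.
  by apply/GH; exists a, b.
have same_test (u v : forall (rT : finGroupType) (H : {group rT}), bool) :
  (forall rT H, u rT H = v rT H) ->
  ((forall rT (H : {group rT}), (H \homg G) = u rT H) <->
   (forall rT (H : {group rT}), (H \homg G) = v rT H)).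
  by move=> E; split=> GH rT H; rewrite GH E.
case: t => [d e f' | d e f' | d e h' f'] [<- <- <- <-]; apply: same_test => // rT H;
  apply: eq_existsb => -[a b] /=; rewrite !xpair_eqE //=.
(* Here l = h, so the relation b^(p^k) = 1 agrees with b^(p^k) = a^(p^h) once a^(p^h) = 1. *)
- by have [-> | _] := eqVneq (a ^+ (p ^ e)) 1; rewrite ?andbF.
- by have [-> | _] := eqVneq (a ^+ (p ^ d)) 1; rewrite ?andbF.
Qed.

Lemma listed_params_bounds t h k l f :
  admissible t -> listed_params t = (h, k, l, f) ->
  [/\ [/\ 0 < h, 0 < k & 0 < f], [/\ f <= h, f <= l & l <= h],
     h <= f + l /\ h <= f + k,
     (group_degrees t).1 + (group_degrees t).2 = (h + k)%N
   & (group_degrees t).2 = maxn h (k + (h - l))].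
Proof.
by case: t => [d e f' | d e f' | d e h' f'] /= adm [<- <- <- <-]; do ?split; lia.
Qed.

(** A presented group maps onto the model, so its order reaches the bound p^(h+k). Conversely, a
    group of this order with such generators maps onto any other group satisfying the relations, by
    [metacyclic_gen_homg]. *)
Lemma presented_byP t h k l f (gT : finGroupType) (G : {group gT}) :
  admissible t -> listed_params t = (h, k, l, f) ->
  presented_by p t G <->
  #|G| = (p ^ (h + k))%N /\ exists a b, metacyclic_gen p h k l f G a b.
Proof.
move=> adm tE; rewrite (presented_by_homg _ tE).
have [[h0 k0 f0] [fh fl lh] [hfl hfk] _ _] := listed_params_bounds adm tE.
have [mT [M [u [v [oM genM]]]]] := metacyclic_gen_model p_pr p_gt2 h0 k0 f0 lh hfl hfk.
split=> [GH | [oG [a [b genG]]] rT H].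
  have [a [b genG]] := (GH _ G).1 (homg_refl _).
  split; last by exists a, b.
  apply/eqP; rewrite eqn_dvd (card_metacyclic_gen_dvdn genG) -oM card_homg //.
  by apply/GH; exists u, v.
split=> [/homgP[g defH] | [c [d genH]]]; last exact: metacyclic_gen_homg oG genG genH.
have [defG ah bk ab] := genG; have [Ga Gb] := metacyclic_gen_in genG.
exists (g a), (g b); split.
- rewrite -defH -(congr1 (fun A : {set gT} => g @* A) defG).
  by rewrite morphimY ?cycle_subG // !morphim_cycle.
- by rewrite -morphX // ah morph1.
- by rewrite -!morphX // bk.
by rewrite -morphJ // ab morphX.
Qed.

Lemma presented_by_isog t (gT1 gT2 : finGroupType) (G1 : {group gT1}) (G2 : {group gT2}) :
  G1 \isog G2 -> presented_by p t G1 -> presented_by p t G2.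
Proof.
rewrite isog_sym => iso12.
by case: t => [d e f | d e f | d e h f] /= pG rT H; rewrite -pG; apply: eq_homgr.
Qed.

Lemma presented_by_exists t : admissible t ->
  exists (gT : finGroupType) (G : {group gT}), presented_by p t G.
Proof.
case tE: (listed_params t) => [[[h k] l] f] adm.
have [[h0 k0 f0] [fh fl lh] [hfl hfk] _ _] := listed_params_bounds adm tE.
have [mT [M [u [v [oM genM]]]]] := metacyclic_gen_model p_pr p_gt2 h0 k0 f0 lh hfl hfk.
by exists mT, M; apply/(presented_byP _ adm tE); split=> //; exists u, v.
Qed.

Lemma eq_leq_iff m n : (forall i, m <= i <-> n <= i) -> m = n.
Proof.
by move=> E; apply/eqP; rewrite eqn_leq; apply/andP; split; apply/E.
Qed.

Lemma presented_by_inj t1 t2 (gT : finGroupType) (G : {group gT}) :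
  admissible t1 -> admissible t2 -> presented_by p t1 G -> presented_by p t2 G -> t1 = t2.
Proof.
move=> adm1 adm2; have p_gt1 := prime_gt1 p_pr.
case tE1: (listed_params t1) => [[[h1 k1] l1] f1].
case tE2: (listed_params t2) => [[[h2 k2] l2] f2].
have [_ [fh1 fl1 lh1] _ D1 E1] := listed_params_bounds adm1 tE1.
have [_ [fh2 fl2 lh2] _ D2 E2] := listed_params_bounds adm2 tE2.
move=> /(presented_byP _ adm1 tE1)[o1 [a1 [b1 gen1]]].
move=> /(presented_byP _ adm2 tE2)[o2 [a2 [b2 gen2]]].
have /eqP := o1; rewrite o2 eqn_exp2l // => /eqP Eo.
have Ee : maxn h1 (k1 + (h1 - l1)) = maxn h2 (k2 + (h2 - l2)).
  apply: eq_leq_iff => n.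
  by rewrite -(metacyclic_gen_exponent p_pr gen1) // -(metacyclic_gen_exponent p_pr gen2).
have /eqP := card_metacyclic_gen_der1 p_pr gen1 o1 fh1.
rewrite (card_metacyclic_gen_der1 p_pr gen2 o2 fh2) eqn_exp2l // => /eqP Ed.
have Eq : maxn f1 k1 = maxn f2 k2.
  apply: eq_leq_iff => n.
  rewrite -(metacyclic_gen_quotient_exponent p_pr gen1) //.
  by rewrite -(metacyclic_gen_quotient_exponent p_pr gen2).
clear - adm1 adm2 tE1 tE2 Eo Ee Ed Eq.
(* The four equalities compare the order, the exponent, the order of G' and the exponent of G/G'.
   They contradict each other for two different families and determine all parameters within one. *)
case: t1 t2 adm1 adm2 tE1 tE2 => [d e f | d e f | d e h f] [d' e' f' | d' e' f' | d' e' h' f'] /=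
  adm1 adm2 [? ? ? ?] [? ? ? ?]; subst; try (exfalso; lia).
- by congr M1; lia.
- by congr M2; lia.
by congr M3; lia.
Qed.

End Presentations.

(** G has order p^(d+e), and exponent p^e by [metacyclic_exponent] for x and y. In the normal form
    this forces (h, k) = (e, d) when k <= l = h, (h, k) = (d, e) when f < l = h < k, and l = d when
    f < l < k with l < h. *)
Lemma bicyclic_listed p d e (gT : finGroupType) (G : {group gT}) x y :
  prime p -> 2 < p -> 0 < d -> d <= e ->
  <[x]> * <[y]> = G -> #[x] = (p ^ d)%N -> #[y] = (p ^ e)%N ->
  #|G| = (p ^ (d + e))%N ->
  exists t, [/\ group_degrees t = (d, e), admissible t & presented_by p t G].
Proof.
move=> p_pr p_gt2 d_gt0 de defG ox oy oG; have p_gt1 := prime_gt1 p_pr.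
have pG : p.-group G by rewrite /pgroup oG pnatX pnat_id.
have mG := bicyclic_metacyclic p_pr p_gt2 pG defG.
have [h [k [l [f [a [b [genG oG' [fh lh] hf cases]]]]]]] := metacyclic_normal_form p_pr p_gt2 pG mG.
have /eqP := oG; rewrite oG' eqn_exp2l // => /eqP Eo.
have genxy : <<[set x; y]>> = G.
  by rewrite -[RHS]genGid -defG genM_join joing_idl joing_idr.
have Ee : maxn h (k + (h - l)) = e.
  apply: eq_leq_iff => n; rewrite -(metacyclic_gen_exponent p_pr genG) //.
  have yn m : (y ^+ (p ^ m) == 1) = (e <= m) by rewrite -order_dvdn oy dvdn_Pexp2l.
  split=> [G1 | en].
    by rewrite -yn G1 // -cycle_subG -defG mulG_subr.
  apply: (metacyclic_exponent p_pr p_gt2 pG mG genxy); apply/eqP; last by rewrite yn.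
  by rewrite -order_dvdn ox dvdn_Pexp2l // (leq_trans de).
have [h0 | h_gt0] := posnP h; first by lia.
have f_gt0 := hf h_gt0.
have [hfl hfk] := metacyclic_gen_bounds p_pr p_gt2 genG oG' f_gt0.
have pres t : listed_params t = (h, k, l, f) -> admissible t -> presented_by p t G.
  by move=> tE adm; apply/(presented_byP p_pr p_gt2 _ adm tE); split=> //; exists a, b.
case: cases => [[Elh kh] | /andP[fl lk]].
  exists (M1 d e f); split=> //; last apply: pres => /=.
  - by rewrite /=; lia.
  - by congr (_, _, _, _); lia.
  by lia.
have [Elh | lh'] := eqVneq l h.
  exists (M2 d e f); split=> //; last apply: pres => /=.
  - by rewrite /=; lia.
  - by congr (_, _, _, _); lia.
  by lia.
exists (M3 d e h f); split=> //; last apply: pres => /=.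
- by rewrite /=; lia.
- by congr (_, _, _, _); lia.
by lia.
Qed.

(** * Regular dessins with complete bipartite graph *)

Section RegularDessin.

Variable D : dessin.
Hypothesis regD : regular_dessin D.

Local Notation rho := (rot_black D).
Local Notation sigma := (rot_white D).

Lemma dessin_autP s : s \in dessin_aut D -> commute s rho /\ commute s sigma.
Proof. by rewrite inE => /andP[_ /andP[/eqP sr /eqP ss]]. Qed.

Lemma perm_commuteX (s r : {perm edge D}) n x : commute s r -> s ((r ^+ n) x) = (r ^+ n) (s x).
Proof. by move=> sr; rewrite -!permM (commuteX n sr). Qed.

Variables m n : nat.
Hypothesis black_m : #|black D| = m.
Hypothesis white_n : #|white D| = n.
Hypothesis complete : forall (b : black D) (w : white D),
  exists! x : edge D, black_end x = b /\ white_end x = w.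

Variable x0 : edge D.

(* The path from x0 to y goes through the edge joining the black end of y to the
   white end of x0. *)
Lemma edge_factor y : exists i j, y = (rho ^+ i) ((sigma ^+ j) x0).
Proof.
have [z [[bz wz] _]] := complete (black_end y) (white_end x0).
have : z \in porbit sigma x0 by rewrite rot_whiteP wz.
case/porbitP=> j Ez; have : y \in porbit rho z by rewrite rot_blackP bz.
by case/porbitP=> i Ey; exists i, j; rewrite -Ez.
Qed.

(** An automorphism commutes with both rotations, and these carry [x0] to every edge. *)
Lemma dessin_aut_semiregular s : s \in dessin_aut D -> s x0 = x0 -> s = 1.
Proof.
case/dessin_autP=> sr ss sx; apply/permP=> y; rewrite perm1.
by have [i [j ->]] := edge_factor y; rewrite (perm_commuteX _ _ sr) (perm_commuteX _ _ ss) sx.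
Qed.

Lemma dessin_aut_move y : exists2 s, s \in dessin_aut D & s x0 = y.
Proof.
have := atransP regD x0 (in_setT _) => E.
have : y \in orbit 'P (dessin_aut D) x0 by rewrite E inE.
by case/orbitP=> s Gs <-; exists s.
Qed.

Lemma expg_dessin_aut (s r : {perm edge D}) i :
  commute s r -> s x0 = r x0 -> (s ^+ i) x0 = (r ^+ i) x0.
Proof.
move=> sr E; elim: i => [|i IHi]; first by rewrite !perm1.
by rewrite expgSr permM IHi perm_commuteX // E -permM -expgS.
Qed.

(** The edges around the black end of [x0] correspond bijectively to their white ends, by
    completeness. *)
Lemma card_porbit_black : #|porbit rho x0| = n.
Proof.
rewrite -white_n.
have inj : {in porbit rho x0 &, injective (@white_end D)}.
  move=> y z; rewrite !rot_blackP => /eqP by_ /eqP bz wyz.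
  have [u [_ uniq]] := complete (black_end x0) (white_end y).
  by rewrite -(uniq y) // (uniq z) // -bz -wyz.
rewrite -(card_in_imset inj) -cardsT; congr #|pred_of_set _|.
apply/setP=> w; rewrite inE; apply/imsetP.
have [u [[bu wu] _]] := complete (black_end x0) w.
by exists u; rewrite // rot_blackP bu.
Qed.

Lemma card_porbit_white : #|porbit sigma x0| = m.
Proof.
rewrite -black_m.
have inj : {in porbit sigma x0 &, injective (@black_end D)}.
  move=> y z; rewrite !rot_whiteP => /eqP wy /eqP wz byz.
  have [u [_ uniq]] := complete (black_end y) (white_end x0).
  by rewrite -(uniq y) // (uniq z) // -wz -byz.
rewrite -(card_in_imset inj) -cardsT; congr #|pred_of_set _|.
apply/setP=> b; rewrite inE; apply/imsetP.
have [u [[bu wu] _]] := complete b (white_end x0).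
by exists u; rewrite // rot_whiteP wu.
Qed.

(** Commutation gives s^i x0 = r^i x0 for all i, so [<[s]>] maps onto the orbit of r; the map is
    injective by semiregularity. *)
Lemma order_dessin_aut (s r : {perm edge D}) :
  s \in dessin_aut D -> commute s r -> s x0 = r x0 -> #[s] = #|porbit r x0|.
Proof.
move=> Gs sr E; rewrite orderE.
have inj : {in <[s]> &, injective (fun g : {perm edge D} => g x0)}.
  move=> g h sg sh /= Egh; apply/eqP; rewrite eq_mulgV1.
  have Gg : <[s]> \subset dessin_aut D by rewrite cycle_subG.
  apply/eqP/dessin_aut_semiregular; first by rewrite groupM ?groupV ?(subsetP Gg).
  by rewrite permM Egh permK.
rewrite -(card_in_imset inj); congr #|pred_of_set _|.
apply/setP=> y; apply/imsetP/porbitP=> [[g /cycleP[i ->] ->] | [i ->]].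
  by exists i; rewrite (expg_dessin_aut _ sr).
by exists (s ^+ i); rewrite ?mem_cycle ?(expg_dessin_aut _ sr).
Qed.

(** Let s and t move [x0] as the black and white rotations do. If g x0 = rho^i sigma^j x0, then g =
    s^i t^j by semiregularity. An element of both cyclic groups keeps both ends of [x0], hence fixes
    [x0]. Both orders of the product are kept because either colour class may be the smaller one. *)
Lemma dessin_aut_bicyclic : exists s t,
  [/\ <[s]> * <[t]> = dessin_aut D, <[t]> * <[s]> = dessin_aut D, #[s] = n, #[t] = m
    & #|dessin_aut D| = (m * n)%N].
Proof.
have [s Gs sx] := dessin_aut_move (rho x0).
have [t Gt tx] := dessin_aut_move (sigma x0).
have [sr _] := dessin_autP Gs; have [tr tt] := dessin_autP Gt.
have os : #[s] = n by rewrite (order_dessin_aut Gs sr sx) card_porbit_black.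
have ot : #[t] = m by rewrite (order_dessin_aut Gt tt tx) card_porbit_white.
have defG : <[s]> * <[t]> = dessin_aut D.
  apply/eqP; rewrite eqEsubset mul_subG ?cycle_subG //=; apply/subsetP=> g Gg.
  have [i [j Eg]] := edge_factor (g x0).
  suff -> : g = s ^+ i * t ^+ j by rewrite mem_mulg ?mem_cycle.
  apply/eqP; rewrite eq_mulgV1; apply/eqP/dessin_aut_semiregular.
    by rewrite groupM ?groupV ?groupM ?groupX.
  rewrite permM Eg; apply: (canLR (permK _)).
  have tjr : commute (t ^+ j) rho by apply/commute_sym/commuteX/commute_sym.
  by rewrite permM (expg_dessin_aut _ sr sx) (perm_commuteX _ _ tjr) (expg_dessin_aut _ tt tx).
have tiG : <[s]> :&: <[t]> = 1.
  apply/trivgP/subsetP=> g /setIP[/cycleP[i Es] /cycleP[j Et]]; apply/set1gP.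
  apply: dessin_aut_semiregular; first by rewrite Es groupX.
  have bg : black_end x0 = black_end (g x0).
    by apply/eqP; rewrite -rot_blackP Es (expg_dessin_aut _ sr sx) mem_porbit.
  have wg : white_end x0 = white_end (g x0).
    by apply/eqP; rewrite -rot_whiteP Et (expg_dessin_aut _ tt tx) mem_porbit.
  have [u [_ uniq]] := complete (black_end x0) (white_end x0).
  by transitivity u; [apply/esym/uniq | apply: uniq].
exists s, t; split=> //; last by rewrite -defG TI_cardMg // -!orderE os ot mulnC.
have: group_set (<[s]> * <[t]>) by rewrite defG groupP.
by move/comm_group_setP=> <-.
Qed.

End RegularDessin.

Local Close Scope group_scope.

Theorem theorem3p7 (p : nat) (p_prime : prime p) (p_gt2 : (2 < p)%N) :
  (forall (d e : nat), (0 < d)%N -> (d <= e)%N ->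
   forall D : dessin,
     regular_dessin D ->
     underlying_complete_bipartite D (p ^ d)%N (p ^ e)%N ->
     exists t : listed_group,
       [/\ group_degrees t = (d, e),
           admissible t
         & presented_by p t (dessin_aut_group D)])
  /\ (forall t : listed_group, admissible t ->
        exists (gT : finGroupType) (G : {group gT}), presented_by p t G)
  /\ (forall t1 t2 : listed_group, admissible t1 -> admissible t2 -> t1 <> t2 ->
      forall (gT1 gT2 : finGroupType) (G1 : {group gT1}) (G2 : {group gT2}),
        presented_by p t1 G1 -> presented_by p t2 G2 -> ~~ (G1 \isog G2)%g).
Proof.
split; last split.
- move=> d e d_gt0 de D regD [cardD complete].
  have [b [w _]] : exists (b : black D) (w : white D), true.
    have /card_gt0P[b _] : 0 < #|black D| by case: cardD => -[-> _]; rewrite expn_gt0 prime_gt0.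
    have /card_gt0P[w _] : 0 < #|white D| by case: cardD => -[_ ->]; rewrite expn_gt0 prime_gt0.
    by exists b, w.
  have [x0 _] := complete b w.
  (* The factor of order p^d must come first: it is [<[t]>] when there are p^d black vertices, and
     [<[s]>] under the opposite colouring. *)
  case: cardD => -[black_card white_card].
    have [s [t [_ defG os ot oG]]] := dessin_aut_bicyclic regD black_card white_card complete x0.
    by apply: (bicyclic_listed p_prime p_gt2 d_gt0 de defG); rewrite // oG expnD.
  have [s [t [defG _ os ot oG]]] := dessin_aut_bicyclic regD black_card white_card complete x0.
  apply: (bicyclic_listed p_prime p_gt2 d_gt0 de defG); rewrite // oG expnD mulnC //.
- exact: presented_by_exists.
move=> t1 t2 adm1 adm2 neq_t gT1 gT2 G1 G2 pG1 pG2; apply/negP=> iso.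
apply: neq_t; apply: (presented_by_inj p_prime p_gt2 adm1 adm2 _ pG2).
exact: presented_by_isog pG1.
Qed.
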